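(* Let $R=\mathbb{Q}[x_1,\dots,x_6]$ and $$I_\Delta=(x_2x_3x_4,\ x_1x_3x_5,\ x_2x_3x_5,\ x_1x_4x_5,\ x_3x_4x_5,\ x_1x_2x_6,\ x_2x_3x_6,\ x_1x_4x_6,\ x_2x_4x_6,\ x_1x_5x_6)\subset R.$$ There does not exist a basic double G-link of the form $I_\Delta=A+fB$ with $A$ and $B$ squarefree monomial ideals of $R$ and $f\in R$ a form that is a sum of monic monomials.
   Context: Basic double G-link (in a standard graded polynomial ring $S$ over a field): all ideals are assumed proper, homogeneous, and saturated with respect to the ideal generated by the variables. An ideal is unmixed if all its associated primes have the same height. $S/A$ is generically Gorenstein if $(S/A)_P$ is Gorenstein for all minimal primes $P$ of $A$. Let $A\subset B$ be unmixed ideals of $S$ such that $S/A$ is Cohen--Macaulay and generically Gorenstein and $\operatorname{ht}(A)+1=\operatorname{ht}(B)$. Let $f\in S$ be homogeneous of degree $d>0$ with $A:f=A$. Then $C=fB+A$ is called a basic double G-link of degree $d$ of $B$ on $A$; the equation $C=fB+A$ is also called a basic double G-link. *)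

(* Defs.v *)
From HB Require Import structures.
From mathcomp Require Import all_boot all_order all_algebra.
From mathcomp Require Import mpoly.

Set Implicit Arguments.
Unset Strict Implicit.
Unset Printing Implicit Defensive.

Import GRing.Theory.
Local Open Scope ring_scope.

(* Ideals are [Prop]-valued subsets, compared extensionally: the ideals below
   are arbitrary, so membership in them need not be decidable. *)

Section Ideals.
Variable R : comNzRingType.
Implicit Types (I J P : R -> Prop) (x y : R).

Definition is_ideal I : Prop :=
  [/\ I 0, forall x y, I x -> I y -> I (x + y) & forall a x, I x -> I (a * x)].

Definition sub_ideal I J : Prop := forall x, I x -> J x.
Definition eq_ideal I J : Prop := forall x, I x <-> J x.

Definition proper_idl I : Prop := is_ideal I /\ ~ I 1.

Definition prime_idl P : Prop :=
  proper_idl P /\ forall x y, P (x * y) -> P x \/ P y.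

Definition maximal_idl P : Prop :=
  proper_idl P /\ forall J, proper_idl J -> sub_ideal P J -> sub_ideal J P.

Definition ideal_gen (G : R -> Prop) : R -> Prop := fun x =>
  exists n (a g : 'I_n -> R), (forall i, G (g i)) /\ x = \sum_(i < n) a i * g i.

Definition ideal_pow I (k : nat) : R -> Prop :=
  ideal_gen (fun x => exists g : 'I_k -> R,
    (forall i, I (g i)) /\ x = \prod_(i < k) g i).

Definition colon I x : R -> Prop := fun y => I (y * x).

(* I is equal to its saturation, the union over k of the ideals I : J^k. *)
Definition saturated_wrt J I : Prop :=
  forall x k, (forall y, ideal_pow J k y -> I (x * y)) -> I x.

Definition prime_chain (n : nat) (Q : nat -> R -> Prop) : Prop :=
  (forall i, (i <= n)%N -> prime_idl (Q i)) /\
  (forall i, (i < n)%N -> sub_ideal (Q i) (Q i.+1) /\ ~ sub_ideal (Q i.+1) (Q i)).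

(* Height is a relation to nat; no n is related to an ideal of infinite height
   nor to the unit ideal. In a Noetherian ring every proper ideal has a
   height. *)
Definition prime_height P (n : nat) : Prop :=
  (exists Q, prime_chain n Q /\ eq_ideal (Q n) P) /\
  (forall m Q, prime_chain m Q -> eq_ideal (Q m) P -> (m <= n)%N).

Definition height I (n : nat) : Prop :=
  (exists P, [/\ prime_idl P, sub_ideal I P & prime_height P n]) /\
  (forall P m, prime_idl P -> sub_ideal I P -> prime_height P m -> (n <= m)%N).

Definition minimal_prime I P : Prop :=
  [/\ prime_idl P, sub_ideal I P &
      forall Q, prime_idl Q -> sub_ideal I Q -> sub_ideal Q P -> sub_ideal P Q].

(* P is the annihilator of an element of R/I. *)
Definition associated_prime I P : Prop :=
  prime_idl P /\ exists x, eq_ideal P (colon I x).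

Definition unmixed I : Prop :=
  exists h, forall P, associated_prime I P -> height P h.

Definition regular_seq (s : seq R) : Prop :=
  ~ ideal_gen (fun x => x \in s) 1 /\
  (forall i y, (i < size s)%N ->
     ideal_gen (fun x => x \in take i s) (y * s`_i) ->
     ideal_gen (fun x => x \in take i s) y).

Definition depth I (n : nat) : Prop :=
  (exists s, [/\ regular_seq s, forall x, x \in s -> I x & size s = n]) /\
  (forall s, regular_seq s -> (forall x, x \in s -> I x) -> (size s <= n)%N).

(* For Noetherian R; this is the form of the definition in Eisenbud,
   Commutative Algebra, 18.2. *)
Definition cohen_macaulay : Prop :=
  forall M, maximal_idl M -> exists n, depth M n /\ height M n.

End Ideals.

Section Gorenstein.
Variable R : comNzRingType.

Definition injective_module (E : lmodType R) : Prop :=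
  forall (M N : lmodType R) (i : {linear M -> N}) (g : {linear M -> E}),
    injective i -> exists h : {linear N -> E}, forall x, h (i x) = g x.

(* An injective resolution of length at most n, unrolled one exact sequence
   0 -> M -> E -> N -> 0 at a time. *)
Inductive injdim_le : nat -> lmodType R -> Prop :=
| Injdim0 n (E : lmodType R) : injective_module E -> injdim_le n E
| InjdimS n (M E N : lmodType R) (i : {linear M -> E}) (p : {linear E -> N}) :
    injective_module E -> injective i -> (forall z, exists y, p y = z) ->
    (forall y, p y = 0 <-> exists x, i x = y) ->
    injdim_le n N -> injdim_le n.+1 M.

(* For local Noetherian R. *)
Definition gorenstein_local : Prop := exists n, injdim_le n R^o.

End Gorenstein.

(* pi presents its target as the quotient of R by I. *)
Definition is_quotient (R Q : comNzRingType) (I : R -> Prop)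
    (pi : {rmorphism R -> Q}) : Prop :=
  (forall q, exists x, pi x = q) /\ (forall x, pi x = 0 <-> I x).

(* loc presents its target as the localization of R at the prime P. *)
Definition is_localization (R T : comNzRingType) (P : R -> Prop)
    (loc : {rmorphism R -> T}) : Prop :=
  [/\ forall u, ~ P u -> exists v, loc u * v = 1,
      forall t, exists x u, ~ P u /\ t * loc u = loc x &
      forall x, loc x = 0 <-> exists u, ~ P u /\ u * x = 0].

Definition quotient_cohen_macaulay (R : comNzRingType) (I : R -> Prop) : Prop :=
  exists (Q : comNzRingType) (pi : {rmorphism R -> Q}),
    is_quotient I pi /\ cohen_macaulay Q.

Definition image_subset (R Q : comNzRingType) (pi : R -> Q) (P : R -> Prop) : Q -> Prop :=
  fun q => exists x, P x /\ pi x = q.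

Definition generically_gorenstein (R : comNzRingType) (I : R -> Prop) : Prop :=
  forall P, minimal_prime I P ->
    exists (Q T : comNzRingType)
           (pi : {rmorphism R -> Q}) (loc : {rmorphism Q -> T}),
      [/\ is_quotient I pi, is_localization (image_subset pi P) loc
        & gorenstein_local T].

Section Polynomials.
Variables (n : nat) (K : fieldType).
Local Notation S := {mpoly K[n]}.
Implicit Types (A B C I : S -> Prop) (f : S).

Definition variables_ideal : S -> Prop :=
  ideal_gen (fun p : S => exists i : 'I_n, p = 'X_i).

Definition homogeneous_idl I : Prop :=
  forall p d, I p -> I (pihomog mdeg d p).

Definition admissible I : Prop :=
  [/\ proper_idl I, homogeneous_idl I & saturated_wrt variables_ideal I].

Definition basic_double_G_link (d : nat) f A B C : Prop :=
  [/\ [/\ admissible A, admissible B, admissible C & sub_ideal A B],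
      [/\ unmixed A, unmixed B, quotient_cohen_macaulay A
        & generically_gorenstein A],
      exists h, height A h /\ height B h.+1,
      [/\ (0 < d)%N, f \is d.-homog & eq_ideal (colon A f) A]
    & eq_ideal C (fun p => exists b a, [/\ B b, A a & p = f * b + a])].

Definition squarefree_monomial_ideal I : Prop :=
  exists G : 'X_{1..n} -> Prop,
    (forall m, G m -> forall i, (m i <= 1)%N) /\
    eq_ideal I (ideal_gen (fun p : S => exists m, G m /\ p = 'X_[m])).

(* Monomials may repeat, so the coefficients of f are natural numbers. *)
Definition sum_of_monic_monomials f : Prop :=
  exists s : seq 'X_{1..n}, f = \sum_(m <- s) 'X_[m].

End Polynomials.

(* xvar k is the variable x_k, for k from 1 to 6. *)
Definition xvar (k : nat) : {mpoly rat[6]} := 'X_(inord k.-1).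

Definition I_Delta : {mpoly rat[6]} -> Prop :=
  ideal_gen (fun p => p \in
    [:: xvar 2 * xvar 3 * xvar 4; xvar 1 * xvar 3 * xvar 5;
        xvar 2 * xvar 3 * xvar 5; xvar 1 * xvar 4 * xvar 5;
        xvar 3 * xvar 4 * xvar 5; xvar 1 * xvar 2 * xvar 6;
        xvar 2 * xvar 3 * xvar 6; xvar 1 * xvar 4 * xvar 6;
        xvar 2 * xvar 4 * xvar 6; xvar 1 * xvar 5 * xvar 6]).

(* Main.v *)
(** Proof idea. Let [Delta] be the complex with Stanley-Reisner ideal [I_Delta]
    and [DA] the one of A. Heights of ideals generated by variables depend
    only on the number of variables and are strictly monotone in it, so that
    unmixedness of A and [ht B = ht A + 1] force all facets of [DA] to have
    four vertices. Restricting [x^T = f b + a], for a nonface T of [Delta]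
    inside a facet G of [DA], to the coordinate subspace of G shows that f
    restricts there to a single squarefree monomial dividing [x^T]. A
    backtracking search over these restrictions leaves one possibility: [DA]
    is the cone with apex x_4 over a Moebius strip on the other five vertices.
    This is not Cohen-Macaulay: a regular sequence of length 4 in the ideal of
    the variables would make the third Koszul cohomology of S/A vanish, while
    a generator of H^1 of the Moebius strip gives a nonzero class there. *)
Require Import Defs.
From HB Require Import structures.
From Stdlib Require Import Classical ClassicalEpsilon.
From mathcomp Require Import all_boot all_order all_algebra.
From mathcomp Require Import fingroup perm mpoly ring.

Set Implicit Arguments.
Unset Strict Implicit.
Unset Printing Implicit Defensive.

Import GRing.Theory.
Local Open Scope ring_scope.

(** * Heights of prime ideals *)

Section Ideals.
Variable R : comNzRingType.
Implicit Types (I J P : R -> Prop).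

Lemma idealB I x y : is_ideal I -> I x -> I y -> I (x - y).
Proof.
by move=> [_ ID IM] Ix Iy; apply: ID => //; rewrite -mulN1r; apply: IM.
Qed.

Lemma ideal_sum I (T : Type) (r : seq T) (F : T -> R) :
  is_ideal I -> (forall i, I (F i)) -> I (\sum_(i <- r) F i).
Proof. by move=> [I0 ID _] IF; apply: big_ind. Qed.

Lemma ideal_genP G : is_ideal (@ideal_gen R G).
Proof.
split.
- exists 0%N, (fun _ => 0), (fun _ => 0); split; first by case.
  by rewrite big_ord0.
- move=> x y [n [a [g [Gg ->]]]] [m [b [h [Gh ->]]]].
  exists (n + m)%N.
  exists (fun i => match split i with inl j => a j | inr j => b j end).
  exists (fun i => match split i with inl j => g j | inr j => h j end).
  split; first by move=> i; case: (split i).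
  rewrite big_split_ord /=; congr (_ + _); apply: eq_bigr => i _.
    by rewrite (unsplitK (inl i)).
  by rewrite (unsplitK (inr i)).
- move=> c x [n [a [g [Gg ->]]]]; exists n, (fun i => c * a i), g; split=> //.
  by rewrite mulr_sumr; apply: eq_bigr => i _; rewrite mulrA.
Qed.

Lemma mem_ideal_gen (G : R -> Prop) x : G x -> ideal_gen G x.
Proof.
move=> Gx; exists 1%N, (fun _ => 1), (fun _ => x); split=> //.
by rewrite big_ord1 mul1r.
Qed.

Lemma ideal_gen_sub (G : R -> Prop) J :
  is_ideal J -> sub_ideal G J -> sub_ideal (ideal_gen G) J.
Proof.
move=> idJ GJ x [n [a [g [Gg ->]]]]; have [_ _ JM] := idJ.
by apply: ideal_sum => // i; apply/JM/GJ.
Qed.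

Lemma prime_idl_prod P (T : Type) (r : seq T) (F : T -> R) :
  prime_idl P -> P (\prod_(i <- r) F i) -> exists i, P (F i).
Proof.
move=> [[_ P1] Pp]; elim: r => [|i r IHr]; first by rewrite big_nil.
by rewrite big_cons => /Pp [Pi|/IHr //]; exists i.
Qed.

Definition chain_to P n := exists Q, @prime_chain R n Q /\ eq_ideal (Q n) P.

Lemma chain_to_extend P P' n : prime_idl P' -> sub_ideal P P' ->
  ~ sub_ideal P' P -> chain_to P n -> chain_to P' n.+1.
Proof.
move=> prP' PP' nP'P [Q [[prQ stQ] QP]].
exists (fun i => if (i <= n)%N then Q i else P'); split; last by rewrite ltnn.
split=> i; first by move=> _; case: ifP => // /prQ.
rewrite ltnS => le_in; rewrite le_in; case: ltnP => [|le_ni]; first exact: stQ.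
have -> : i = n by apply/eqP; rewrite eqn_leq le_in.
by split=> [x /QP /PP' //|P'Q]; apply: nP'P => x /P'Q /QP.
Qed.

Lemma chain_to_eq P P' n : eq_ideal P P' -> chain_to P n -> chain_to P' n.
Proof.
move=> PP' [Q [ch QP]]; exists Q; split=> // x.
by split=> [/QP/PP'|/PP'/QP].
Qed.

Lemma prime_height_lt P P' n n' : prime_height P n -> prime_height P' n' ->
  prime_idl P' -> sub_ideal P P' -> ~ sub_ideal P' P -> (n < n')%N.
Proof.
move=> [chP _] [_ maxP'] prP' PP' nP'P.
by have [Q [chQ QP']] := chain_to_extend prP' PP' nP'P chP; apply: maxP' chQ QP'.
Qed.

Lemma chain_to_le P P' n n' : prime_height P' n' -> prime_idl P' ->
  sub_ideal P P' -> chain_to P n -> (n <= n')%N.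
Proof.
move=> [_ maxP'] prP' PP' chP; have [P'P|nP'P] := classic (sub_ideal P' P).
  have [Q [chQ QP']] : chain_to P' n.
    by apply: chain_to_eq chP => x; split; [apply: PP'|apply: P'P].
  exact: maxP' chQ QP'.
have [Q [chQ QP']] := chain_to_extend prP' PP' nP'P chP.
exact: ltnW (maxP' _ _ chQ QP').
Qed.

(** Height is a relation, so existence needs proof: chains ending at [P] have length at most the
    height of [P'], hence a longest one exists. *)
Lemma prime_height_exists P P' n' : prime_idl P -> prime_idl P' ->
  sub_ideal P P' -> prime_height P' n' ->
  exists2 n, prime_height P n & (n <= n')%N.
Proof.
move=> prP prP' PP' htP'.
have bnd m : chain_to P m -> (m <= n')%N by apply: chain_to_le htP' prP' PP'.
have ch0 : chain_to P 0 by exists (fun=> P).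
have [m [chm maxm]] : exists m, chain_to P m /\ ~ chain_to P m.+1.
  apply: NNPP => no; have allch k : chain_to P k.
    by elim: k => // k IHk; apply: NNPP => nch; apply: no; exists k.
  by have := bnd _ (allch n'.+1); rewrite ltnn.
suff [k [chk maxk]] : exists k, chain_to P k /\ forall j, chain_to P j -> (j <= k)%N.
  exists k; last exact: bnd.
  by split=> // j Q chQ QP; apply: maxk; exists Q.
have [b] := ubnP (n' - m)%N.
clear maxm; elim: b m chm => // b IHb m chm; rewrite ltnS => lt_b.
have [[j [chj lt_mj]]|no] := classic (exists j, chain_to P j /\ (m < j)%N).
  apply: (IHb j) => //; apply: leq_trans lt_b; apply: ltn_sub2l => //.
  exact: leq_trans lt_mj (bnd _ chj).
exists m; split=> // j chj; rewrite leqNgt; apply/negP => lt_mj.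
by apply: no; exists j.
Qed.

(** Among the primes containing [P] the smallest is [P] itself, so the minimum in [height] is
    attained there. *)
Lemma prime_height_of_height P h : prime_idl P -> height P h -> prime_height P h.
Proof.
move=> prP [[P' [prP' PP' htP']] minP].
have [n htn le_nh] := prime_height_exists prP prP' PP' htP'.
have le_hn : (h <= n)%N by apply: minP htn => // x.
by rewrite (_ : h = n) //; apply/eqP; rewrite eqn_leq le_hn.
Qed.

Lemma prime_height_inj P m n : prime_height P m -> prime_height P n -> m = n.
Proof.
move=> [[Q [cQ QP]] mP] [[Q' [cQ' Q'P]] mP'].
by apply/eqP; rewrite eqn_leq (mP' _ _ cQ QP) (mP _ _ cQ' Q'P).
Qed.

Lemma prime_idl_comap (S : comNzRingType) (f : {rmorphism S -> R}) P :
  prime_idl P -> prime_idl (fun x => P (f x)).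
Proof.
move=> [[[P0 PD PM] P1] Pp]; split; last by move=> x y; rewrite rmorphM; apply: Pp.
split; last by rewrite rmorph1.
split=> [|x y|a x]; first by rewrite rmorph0.
  by rewrite rmorphD; apply: PD.
by rewrite rmorphM; apply: PM.
Qed.

(** The right inverse [g] makes [f] onto, which keeps the pulled back inclusions strict. *)
Lemma chain_to_comap (f g : {rmorphism R -> R}) P n : cancel g f ->
  chain_to P n -> chain_to (fun x => P (f x)) n.
Proof.
move=> gK [Q [[prQ stQ] QP]].
exists (fun i x => Q i (f x)); split; last by move=> x; apply: QP.
split=> i lei; first exact/prime_idl_comap/prQ.
have [QQ nQQ] := stQ i lei; split=> [x /QQ //|sub].
by apply: nQQ => x; rewrite -(gK x); apply: sub.
Qed.

Lemma prime_height_comap (f g : {rmorphism R -> R}) P n : cancel g f ->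
  cancel f g -> prime_height P n -> prime_height (fun x => P (f x)) n.
Proof.
move=> gK fK [chP maxP]; split; first exact: chain_to_comap gK chP.
move=> m Q chQ QP.
have [Q' [chQ' QP']] : chain_to P m.
  have := @chain_to_comap g f (fun x => P (f x)) m fK (ex_intro _ Q (conj chQ QP)).
  by apply: chain_to_eq => x; rewrite gK.
exact: maxP chQ' QP'.
Qed.

Lemma prime_height_eq P P' n :
  eq_ideal P P' -> prime_height P n -> prime_height P' n.
Proof.
move=> PP' [chP maxP]; split; first exact: chain_to_eq chP.
move=> m Q chQ QP'; apply: maxP chQ _ => x.
by split=> [/QP'/PP'|/PP'/QP'].
Qed.

End Ideals.

(** * Monomials and primes generated by variables *)

Section Monomials.
Variables (n : nat) (K : fieldType).
Local Notation S := {mpoly K[n]}.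
Implicit Types (p q : S) (m : 'X_{1..n}) (V W G : {set 'I_n}).

Definition mvars m : {set 'I_n} := [set i | m i != 0%N].

Definition sqfree V : 'X_{1..n} := [multinom (i \in V : nat) | i < n].

Lemma mvars_sqfree V : mvars (sqfree V) = V.
Proof. by apply/setP => i; rewrite inE mnmE; case: (i \in V). Qed.

Lemma mvarsD m m' : mvars (m + m')%MM = mvars m :|: mvars m'.
Proof. by apply/setP => i; rewrite !inE mnmDE addn_eq0 negb_and. Qed.

Lemma sqfree_le V m : (sqfree V <= m)%MM = (V \subset mvars m).
Proof.
apply/mnm_lepP/subsetP => [le i iV|sub i].
  by have := le i; rewrite mnmE iV inE lt0n.
by rewrite mnmE; case: (boolP (i \in V)) => // /sub; rewrite inE lt0n.
Qed.

Lemma mem_mvars0 m : mvars m = set0 -> m = 0%MM.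
Proof.
move=> m0; apply/mnmP => i; rewrite mnm0E; apply/eqP/negPn.
by have := in_set0 i; rewrite -m0 inE => ->.
Qed.

Definition varsub V : S -> S :=
  mmap (@mpolyC n K) (fun i => if i \in V then 0 else 'X_i).

HB.instance Definition _ V := GRing.RMorphism.on (varsub V).

Lemma varsubX V m :
  varsub V 'X_[m] = if mvars m \subset ~: V then 'X_[m] else 0.
Proof.
rewrite /varsub mmapX /mmap1; case: (boolP (_ \subset _)) => [/subsetP sub|] /=.
  rewrite [RHS]mpolyXE_id; apply: eq_bigr => i _; case: ifP => // iV.
  case: (eqVneq (m i) 0%N) => [->|mi]; first by rewrite !expr0.
  by have := sub i; rewrite !inE mi iV => /(_ isT).
case/subsetPn => i; rewrite !inE negbK => mi iV.
by rewrite (bigD1 i) //= iV expr0n (negbTE mi) mul0r.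
Qed.

Lemma mcoeff_varsub V p m :
  (varsub V p)@_m = if mvars m \subset ~: V then p@_m else 0.
Proof.
have E k : (varsub V (p@_k *: 'X_[k]))@_m =
    if mvars m \subset ~: V then (p@_k *: 'X_[k])@_m else 0.
  rewrite {1}/varsub mmapZ -/(varsub V _) varsubX mul_mpolyC.
  case: ifP => sk; first by rewrite mcoeffZ mcoeffX; case: eqP => [<-|_];
    rewrite ?sk ?mulr0 ?if_same.
  rewrite scaler0 mcoeff0 mcoeffZ mcoeffX; case: eqP => [<-|_]; rewrite ?sk //.
  by rewrite mulr0 if_same.
rewrite [p in LHS]mpolyE rmorph_sum raddf_sum /= (eq_bigr _ (fun k _ => E k)).
by case: ifP => _; rewrite ?big1_eq // -raddf_sum /= -mpolyE.
Qed.

(* The ideal generated by the variables in [V], as a kernel: this makes it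
   prime at once. *)
Definition vprime V : S -> Prop := fun p => varsub V p = 0.

Lemma vprimeP V p :
  vprime V p <-> forall m, p@_m != 0 -> ~~ (mvars m \subset ~: V).
Proof.
split=> [Vp m pm|H].
  apply: contraNN pm => sub; have := mcoeff_varsub V p m.
  by rewrite Vp sub mcoeff0 => <-.
apply/mpolyP => m; rewrite mcoeff_varsub mcoeff0; case: ifP => // sub.
by apply/eqP; apply: contraTT sub => /H.
Qed.

Lemma vprimeX V m : vprime V 'X_[m] <-> ~~ (mvars m \subset ~: V).
Proof.
split=> [/vprimeP|H]; last by rewrite /vprime varsubX (negbTE H).
by apply; rewrite mcoeffX eqxx oner_eq0.
Qed.

Lemma vprime_prime V : prime_idl (vprime V).
Proof.
rewrite /vprime; split; last first.
  by move=> p q /eqP; rewrite rmorphM /= mulf_eq0 => /orP[] /eqP; [left|right].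
split; last by rewrite rmorph1; apply/eqP/oner_neq0.
split=> [|p q|a p]; first by rewrite rmorph0.
  by rewrite rmorphD /= => -> ->; rewrite addr0.
by rewrite rmorphM /= => ->; rewrite mulr0.
Qed.

Lemma vprime_sub V W : V \subset W -> sub_ideal (vprime V) (vprime W).
Proof.
move=> VW p /vprimeP Vp; apply/vprimeP => m /Vp.
by apply: contraNN => /subset_trans; apply; rewrite setCS.
Qed.

Lemma vprime_subset V W : sub_ideal (vprime V) (vprime W) -> V \subset W.
Proof.
move=> VW; apply/subsetP => i iV.
have : vprime W 'X_i.
  by apply: VW; apply/vprimeX/subsetPn; exists i; rewrite !inE ?mnm1E ?eqxx ?iV.
move/vprimeX/subsetPn => [j]; rewrite !inE mnm1E negbK.
by case: (eqVneq i j) => [->|].  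
Qed.

Lemma mpolyX_split m i : m i != 0%N -> 'X_[m] = 'X_[m - U_(i)] * 'X_i :> S.
Proof.
move=> mi; rewrite -mpolyXD submK //.
apply/mnm_lepP => j; rewrite mnm1E; case: eqP => // <-; by rewrite lt0n.
Qed.

Lemma vprime1_dvd i p : vprime [set i] p -> exists q, p = q * 'X_i.
Proof.
move=> /vprimeP ip; exists (\sum_(m <- msupp p) p@_m *: 'X_[m - U_(i)]).
rewrite {1}[p]mpolyE big_distrl /= big_seq [RHS]big_seq.
apply: eq_bigr => m; rewrite mcoeff_msupp -scalerAl => /ip /subsetPn [j].
by rewrite !inE negbK => mj /eqP ji; rewrite -mpolyX_split // -ji.
Qed.

(** Induction on the degree of [m]: a variable dividing the product divides [p] or [q], because
    [vprime [set i]] is prime, and can be cancelled. *)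
Lemma monomial_factor p q m c : c != 0 -> p * q = c *: 'X_[m] ->
  exists c' m', p = c' *: 'X_[m'].
Proof.
move=> c0; have [d] := ubnP (mdeg m); elim: d m p q => // d IHd m p q.
rewrite ltnS => le_md pqE.
have cX0 : c *: 'X_[m] != 0 :> S.
  apply/eqP => /mpolyP /(_ m) /eqP; rewrite mcoeffZ mcoeffX eqxx mulr1 mcoeff0.
  exact/negP.
have /andP[p0 q0] : (p != 0) && (q != 0) by rewrite -negb_or -mulf_eq0 pqE.
have [m0|[i]] := set_0Vmem (mvars m).
  (* [msize] of a nonzero polynomial is its degree plus one, so [p] must be constant. *)
  have: msize (p * q) = 1%N.
    by rewrite pqE (mem_mvars0 m0) mpolyX0 -mul_mpolyC mulr1 msizeC c0.
  rewrite msizeM // (mpolySpred _ p0) (mpolySpred _ q0) addnS /= => E.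
  exists (p@_0%MM), 0%MM; rewrite mpolyX0 -mul_mpolyC mulr1.
  apply: msize1_polyC; rewrite (mpolySpred _ p0) -E; exact: leq_addr.
rewrite inE => mi; move: pqE; rewrite (mpolyX_split mi) scalerAl => pqE.
have lt_d : (mdeg (m - U_(i))%MM < d)%N.
  apply: leq_trans le_md; rewrite -{2}[m](submK (m' := m) (m := U_(i)%MM)).
    by rewrite mdegD mdeg1 addn1.
  by apply/mnm_lepP => j; rewrite mnm1E; case: eqP => // <-; rewrite lt0n.
have Xi0 : 'X_i != 0 :> S.
  by apply/eqP => /mpolyP /(_ U_(i)%MM) /eqP; rewrite mcoeffX eqxx mcoeff0 oner_eq0.
have Vi : vprime [set i] (p * q).
  rewrite /vprime pqE rmorphM /= [X in _ * X](_ : _ = 0) ?mulr0 //.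
  by apply/vprimeX/subsetPn; exists i; rewrite !inE ?mnm1E eqxx.
have [_ /(_ _ _ Vi) [] /vprime1_dvd [r rE]] := vprime_prime [set i].
  have [||c' [m' r'E]] := IHd (m - U_(i))%MM r q => //.
    by apply: (mulIf Xi0); rewrite -pqE rE mulrAC.
  by exists c', (m' + U_(i))%MM; rewrite rE r'E mpolyXD scalerAl.
have [||c' [m' r'E]] := IHd (m - U_(i))%MM p r => //.
  by apply: (mulIf Xi0); rewrite -pqE rE mulrA.
by exists c', m'.
Qed.

Lemma scaleX_inj c c' m m' : c != 0 -> c *: 'X_[m] = c' *: 'X_[m'] :> S -> m = m'.
Proof.
move=> c0 /mpolyP/(_ m)/eqP; rewrite !mcoeffZ !mcoeffX eqxx mulr1.
by case: (eqVneq m' m) => // _; rewrite mulr0 (negbTE c0).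
Qed.

Lemma mpolyX_factor p q m : 'X_[m] = p * q -> exists c c' m' m'',
  [/\ c != 0, c' != 0, p = c *: 'X_[m'], q = c' *: 'X_[m''] & m = (m' + m'')%MM].
Proof.
move=> E; have X1 k : 'X_[k] = 1 *: 'X_[k] :> S by rewrite scale1r.
have [c [m' pE]] := monomial_factor (oner_neq0 K) (etrans (esym E) (X1 m)).
have [c' [m'' qE]] : exists c' m'', q = c' *: 'X_[m''].
  by apply: (@monomial_factor q p m 1); rewrite ?oner_neq0 // mulrC -E.
have E' : 1 *: 'X_[m] = (c * c') *: 'X_[m' + m''] :> S.
  by rewrite scale1r E pE qE mpolyXD -scalerAl -scalerAr scalerA.
exists c, c', m', m''; split=> //; last exact: scaleX_inj (oner_neq0 K) E'.
  apply/eqP => c0; have /mpolyP/(_ m)/eqP := E'.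
  by rewrite c0 mul0r scale0r scale1r mcoeffX eqxx mcoeff0 oner_eq0.
apply/eqP => c0; have /mpolyP/(_ m)/eqP := E'.
by rewrite c0 mulr0 scale0r scale1r mcoeffX eqxx mcoeff0 oner_eq0.
Qed.

Lemma varsub_mcoeff V f c m : varsub V f = c *: 'X_[m] -> mvars m \subset ~: V ->
  f@_m = c.
Proof.
move=> /(congr1 (mcoeff m)); rewrite mcoeff_varsub => + mV.
by rewrite mV mcoeffZ mcoeffX eqxx mulr1.
Qed.

(** The monomial [m] survives both substitutions, so its coefficient in [f] can be read off from
    either. *)
Lemma varsub_monomial_overlap V W f c c' m m' : c != 0 ->
  varsub V f = c *: 'X_[m] -> varsub W f = c' *: 'X_[m'] ->
  mvars m \subset ~: V -> mvars m \subset ~: W -> m' = m.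
Proof.
move=> c0 fV fW mV mW; apply/eqP; have := congr1 (mcoeff m) fW.
rewrite mcoeff_varsub mW (varsub_mcoeff fV mV) mcoeffZ mcoeffX => /eqP.
by case: (m' == m) => //; rewrite mulr0 (negbTE c0).
Qed.

Lemma sqfree_ideal_gen (A : S -> Prop) p m : squarefree_monomial_ideal A ->
  A p -> p@_m != 0 ->
  exists m', [/\ forall i, (m' i <= 1)%N, A 'X_[m'] & (m' <= m)%MM].
Proof.
move=> [G [sqG AG]] /AG [k [a [g [Gg pE]]]] pm.
have [i] : exists i, (a i * g i)@_m != 0.
  apply: NNPP => no; move: pm; rewrite pE raddf_sum big1 ?eqxx //= => i _.
  by apply/eqP/negPn/negP => nz; apply: no; exists i.
have [m' [Gm' gE]] := Gg i; rewrite gE => nz.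
exists m'; split; [exact: sqG|by apply/AG/mem_ideal_gen; exists m'|].
move: nz; rewrite -mcoeff_msupp (perm_mem (msuppMX _ _)) => /mapP[k' _ ->].
exact: lem_addr.
Qed.

End Monomials.

(** * Heights of primes generated by variables *)

Section PrimeHeights.
Variables (n : nat) (K : fieldType).
Implicit Types (V W : {set 'I_n}).
Local Notation vprime := (@vprime n K).

Lemma vprime_msym (s : 'S_n) V :
  eq_ideal (fun p => vprime V (msym s p)) (vprime (s @^-1: V)).
Proof.
move=> p; split=> /vprimeP H; apply/vprimeP => m; last first.
  rewrite mcoeff_sym => /H /subsetPn[i]; rewrite !inE mnmE negbK => mi iV.
  by apply/subsetPn; exists (s i); rewrite !inE ?iV.
rewrite -(mpermK s m) -mcoeff_sym => /H /subsetPn[i].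
rewrite !inE !mnmE negbK => mi iV; apply/subsetPn.
by exists (s^-1%g i); rewrite !inE ?mnmE permKV // iV.
Qed.

(* [V] is moved to [W] one transposition of variables at a time. *)
Lemma vprime_height_card V W h :
  #|V| = #|W| -> prime_height (vprime V) h -> prime_height (vprime W) h.
Proof.
have [b] := ubnP #|V :\: W|; elim: b V => // b IHb V; rewrite ltnS => le_b eVW htV.
have [VW0|[i]] := set_0Vmem (V :\: W).
  have VW : V \subset W by rewrite -setD_eq0 VW0.
  by have /eqP <- : V == W by rewrite eqEcard VW eVW /=.
rewrite inE => /andP[iW iV].
have [WV0|[j]] := set_0Vmem (W :\: V).
  have /eqP WV : W == V.
    by rewrite eqEcard -setD_eq0 WV0 eqxx eVW leqnn.
  by rewrite WV iV in iW.
rewrite inE => /andP[jV jW].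
have sVE : tperm i j @^-1: V = j |: (V :\ i).
  apply/setP => x; rewrite !inE; case: tpermP => [->|->|/eqP xi /eqP xj].
  - by rewrite (negbTE jV) eqxx orbF; case: eqP jV iV => // <- /negP.
  - by rewrite eqxx iV.
  - by rewrite xi (negbTE xj).
apply: (IHb (j |: (V :\ i))).
- rewrite setDUl; apply: leq_trans le_b; apply/proper_card.
  apply/properP; split; last first.
    exists i; first by rewrite inE iV iW.
    rewrite !inE eqxx /= andbF orbF; case: eqP => [ij|_]; last by rewrite andbF.
    by rewrite -ij iV in jV.
  apply/subsetP => x; rewrite !inE => /orP[/andP[xW /eqP xj]|/and3P[-> _ ->] //].
  by rewrite xj jW in xW.
- by rewrite -eVW cardsU1 !inE (negbTE jV) andbF (cardsD1 i V) iV.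
- rewrite -sVE.
  apply: prime_height_eq (vprime_msym _ _) _.
  apply: (@prime_height_comap _ (msym (tperm i j)) (msym (tperm i j))) => //.
    by move=> p; rewrite /= -msymMm tperm2 msym1m.
  by move=> p; rewrite /= -msymMm tperm2 msym1m.
Qed.

Lemma subset_of_card V k : (k <= #|V|)%N ->
  exists2 W : {set 'I_n}, W \subset V & #|W| = k.
Proof.
move=> le_k; exists [set x in take k (enum V)].
  by apply/subsetP => x; rewrite inE => /mem_take; rewrite mem_enum.
by rewrite cardsE (card_uniqP (take_uniq _ (enum_uniq _))) size_takel // -cardE.
Qed.

Lemma vprime_not_sub V W : V \proper W -> ~ sub_ideal (vprime W) (vprime V).
Proof. by move=> /properP[_ [x xW /negP xV]] /vprime_subset /subsetP /(_ x xW). Qed.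

Lemma vprime_height_lt V W h k : prime_height (vprime V) h ->
  prime_height (vprime W) k -> V \proper W -> (h < k)%N.
Proof.
move=> hV hW VW; apply: prime_height_lt hV hW (vprime_prime _ _) _ _.
  exact/vprime_sub/proper_sub.
exact: vprime_not_sub.
Qed.

(** Otherwise some proper subset of [V] would have the size, hence the height [k], of [W], giving
    [k < h]. *)
Lemma vprime_height_card_le V W h k : prime_height (vprime V) h ->
  prime_height (vprime W) k -> (h <= k)%N -> (#|V| <= #|W|)%N.
Proof.
move=> hV hW le_hk; rewrite leqNgt; apply/negP => lt_WV.
have [U UV cU] := subset_of_card (ltnW lt_WV).
have hU := vprime_height_card (esym cU) hW.
have := vprime_height_lt hU hV; rewrite properEcard UV cU lt_WV ltnNge le_hk.
by move/(_ isT).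
Qed.

Lemma vprime_height_card_eq V W h : prime_height (vprime V) h ->
  prime_height (vprime W) h -> #|V| = #|W|.
Proof.
by move=> hV hW; apply/eqP; rewrite eqn_leq !(@vprime_height_card_le _ _ h h).
Qed.

(** A larger gap in size leaves room for a set strictly in between, whose height would lie strictly
    between [h] and [h.+1]. *)
Lemma vprime_height_succ V W h : prime_height (vprime V) h ->
  prime_height (vprime W) h.+1 -> #|W| = #|V|.+1.
Proof.
move=> hV hW; apply/eqP; rewrite eqn_leq andbC; apply/andP; split.
  rewrite ltn_neqAle (vprime_height_card_le hV hW) // andbT.
  apply/eqP => eVW; have := prime_height_inj hW (vprime_height_card eVW hV).
  by move/eqP; rewrite eqn_leq ltnn.
rewrite leqNgt; apply/negP => lt_VW.
have [X XW cX] := subset_of_card (ltnW lt_VW).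
have [U UX cU] : exists2 U : {set 'I_n}, U \subset X & #|U| = #|V|.
  by apply: subset_of_card; rewrite cX.
have hU := vprime_height_card (esym cU) hV.
have [x hX _] := prime_height_exists (vprime_prime K X) (vprime_prime _ _)
  (vprime_sub XW) hW.
have := vprime_height_lt hU hX; have := vprime_height_lt hX hW.
rewrite !properEcard XW UX cX cU lt_VW ltnSn => /(_ isT) lt_xh /(_ isT).
by rewrite ltnNge -ltnS lt_xh.
Qed.

End PrimeHeights.

(** * Squarefree monomial ideals, their facets and associated primes *)

Section SquarefreeIdeals.
Variables (n : nat) (K : fieldType) (A : {mpoly K[n]} -> Prop).
Hypothesis sqA : squarefree_monomial_ideal A.
Implicit Types (V W G : {set 'I_n}).
Local Notation vprime := (@vprime n K).

Lemma sqfree_ideal : is_ideal A.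
Proof.
have [G [_ AG]] := sqA; have [g0 gD gM] := ideal_genP
  (fun p : {mpoly K[n]} => exists m, G m /\ p = 'X_[m]).
split=> [|x y /AG Ax /AG Ay|a x /AG Ax]; apply/AG => //; first exact: gD.
exact: gM.
Qed.

Lemma sqfree_ideal_le m m' : (m <= m')%MM -> A 'X_[m] -> A 'X_[m'].
Proof.
move=> le Am; have [_ _ AM] := sqfree_ideal.
by rewrite -(submK le) mpolyXD; apply: AM.
Qed.

Lemma sqfree_idealX m : A 'X_[m] -> A 'X_[sqfree (mvars m)].
Proof.
move=> Am; have [|m' [sqm' Am' le]] := sqfree_ideal_gen (m := m) sqA Am.
  by rewrite mcoeffX eqxx oner_eq0.
apply: sqfree_ideal_le Am'; apply/mnm_lepP => j; rewrite mnmE inE.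
have := mnm_lepP le j; case: (m j) => [|b] //= _; exact: sqm'.
Qed.

Lemma sqfree_idealXS m m' : mvars m \subset mvars m' -> A 'X_[m] -> A 'X_[m'].
Proof.
by move=> sub /sqfree_idealX; apply: sqfree_ideal_le; rewrite sqfree_le.
Qed.

Lemma sqfree_ideal_mcoeff p m : A p -> p@_m != 0 -> A 'X_[m].
Proof.
move=> Ap pm; have [m' [_ Am' le]] := sqfree_ideal_gen sqA Ap pm.
exact: sqfree_ideal_le Am'.
Qed.

Lemma sqfree_idealP p : A p <-> forall m, p@_m != 0 -> A 'X_[m].
Proof.
split=> [Ap m|H]; first exact: sqfree_ideal_mcoeff.
have [A0 AD AM] := sqfree_ideal.
rewrite [p]mpolyE big_seq; apply: big_ind => // m.
by rewrite mcoeff_msupp -mul_mpolyC => /H; apply: AM.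
Qed.

Lemma sub_vprimeP V :
  sub_ideal A (vprime V) <-> ~ A 'X_[sqfree (~: V)].
Proof.
split=> [sub /sub/vprimeX|nA p Ap]; first by rewrite mvars_sqfree subxx.
apply/vprimeP => m /(sqfree_ideal_mcoeff Ap) Am; apply/negP => sub.
by apply: nA; apply: sqfree_idealXS Am; rewrite mvars_sqfree.
Qed.

(** [V] collects the variables in [P]. Were the product of the other variables in [A], one of them
    would lie in the prime [P]. *)
Lemma prime_over_sqfree P : prime_idl P -> sub_ideal A P ->
  exists V, sub_ideal A (vprime V) /\ sub_ideal (vprime V) P.
Proof.
move=> prP AP.
have [f fP] : exists f : 'I_n -> bool, forall i, f i <-> P 'X_i.
  apply: (ClassicalEpsilon.choice (fun i b => is_true b <-> P 'X_i)) => i.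
  by have [Pi|nPi] := classic (P 'X_i); [exists true|exists false].
have [[[P0 PD PM] _] _] := prP.
exists [set i | f i]; split.
  apply/sub_vprimeP => /AP; rewrite mpolyXE_id => /(prime_idl_prod prP) [i].
  rewrite mnmE !inE; case Ei: (f i) => /= Pi; last first.
    by have := fP i; rewrite Ei => -[_ /(_ Pi)].
  by have [[_ P1] _] := prP; rewrite expr0 in Pi.
move=> p /vprimeP Vp; rewrite [p]mpolyE big_seq; apply: big_ind => // m.
rewrite mcoeff_msupp -mul_mpolyC => /Vp /subsetPn [i]; rewrite !inE negbK => mi /fP Pi.
by apply: (PM); rewrite (mpolyX_split _ mi); apply: PM.
Qed.

(** A maximal face of the Stanley-Reisner complex of [A]; testing one added vertex suffices because
    subsets of faces are faces. *)
Definition facet G :=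
  ~ A 'X_[sqfree G] /\ forall i, i \notin G -> A 'X_[sqfree (i |: G)].

Lemma facet_exists V : ~ A 'X_[sqfree V] -> exists2 G, facet G & V \subset G.
Proof.
have [b] := ubnP #|~: V|; elim: b V => // b IHb V; rewrite ltnS => le_b nAV.
have [fV|nfV] := classic (facet V); first by exists V.
have [i [iV nAi]] : exists i, i \notin V /\ ~ A 'X_[sqfree (i |: V)].
  apply: NNPP => no; apply: nfV; split=> // i iV; apply: NNPP => nAi.
  by apply: no; exists i.
have [|G fG sub] := IHb (i |: V) _ nAi; last first.
  by exists G => //; apply: subset_trans sub; apply: subsetUr.
apply: leq_trans le_b; apply/proper_card; rewrite properC; apply/properP.
by split; [apply: subsetUr|exists i; rewrite ?setU11].
Qed.

(** By maximality, a variable outside [G] times the monomial of [G] lies in [A]. Conversely, the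
    prime contains [A] but not that monomial, hence contains the colon ideal. *)
Lemma facet_colon G : facet G -> eq_ideal (vprime (~: G)) (colon A 'X_[sqfree G]).
Proof.
move=> [nA fA] p; have prG := vprime_prime K (~: G); split=> [/vprimeP Vp|Ap].
  apply/sqfree_idealP => m; rewrite -mcoeff_msupp (perm_mem (msuppMX _ _)).
  case/mapP => m'; rewrite mcoeff_msupp => /Vp /subsetPn [i].
  rewrite setCK => mi iG ->; apply: sqfree_idealXS (fA i iG).
  by rewrite !mvarsD !mvars_sqfree subUset subsetUl sub1set inE mi orbT.
have : vprime (~: G) (p * 'X_[sqfree G]).
  by move: Ap; apply: (proj2 (sub_vprimeP (~: G))); rewrite setCK.
case/(proj2 prG) => // /vprimeX; by rewrite mvars_sqfree setCK subxx.
Qed.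

Lemma facet_associated G : facet G -> associated_prime A (vprime (~: G)).
Proof.
by move=> fG; split; [exact: vprime_prime|exists 'X_[sqfree G]; exact: facet_colon].
Qed.

Lemma height_cover h : height A h ->
  exists V, sub_ideal A (vprime V) /\ prime_height (vprime V) h.
Proof.
move=> [[P [prP AP htP]] minA].
have [V [AV VP]] := prime_over_sqfree prP AP.
have [m htV le_mh] := prime_height_exists (vprime_prime _ _) prP VP htP.
exists V; split=> //; suff <- : m = h by [].
by apply/eqP; rewrite eqn_leq le_mh (minA _ _ (vprime_prime _ _) AV htV).
Qed.

(** Unmixedness gives all facet primes one height [h0]. A prime of height [h] generated by variables
    contains a facet prime, so [h0 <= h]; minimality gives [h <= h0]. *)
Lemma unmixed_facet_height G h : unmixed A -> height A h -> facet G ->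
  prime_height (vprime (~: G)) h.
Proof.
move=> [h0 unm] htA.
have ht_facet F : facet F -> prime_height (vprime (~: F)) h0.
  by move=> /facet_associated /unm; apply: prime_height_of_height; apply: vprime_prime.
suff -> : h = h0 by apply: ht_facet.
have [V [AV htV]] := height_cover htA.
have [F fF sub] := facet_exists (proj1 (sub_vprimeP V) AV).
have [_ minA] := htA; apply/eqP; rewrite eqn_leq.
rewrite (minA _ _ (vprime_prime _ _) _ (ht_facet F fF)); last first.
  by apply/sub_vprimeP; rewrite setCK; case: fF.
apply: (chain_to_le htV (vprime_prime _ _) _ (proj1 (ht_facet F fF))).
by apply: vprime_sub; rewrite -[V]setCK setCS.
Qed.

End SquarefreeIdeals.

(** * Koszul cohomology and regular sequences *)

Section Koszul.
Variables (R : comNzRingType) (I : finType).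
Implicit Types (x y : I -> R) (u v : seq I -> R) (s t : seq I) (J : R -> Prop).

(* Cochains are functions of all words, not only alternating ones: this keeps
   [kd_homotopy] free of signs. *)
Fixpoint kd x u t : R :=
  if t is i :: t' then x i * u t' - kd x (fun s => u (i :: s)) t' else 0.

Lemma eq_kd x u v t : u =1 v -> kd x u t = kd x v t.
Proof.
elim: t u v => //= i t IHt u v uv; rewrite uv; congr (_ - _).
by apply: IHt => s; apply: uv.
Qed.

Lemma eq_kdl x y u t : x =1 y -> kd x u t = kd y u t.
Proof. by move=> xy; elim: t u => //= i t IHt u; rewrite xy IHt. Qed.

Lemma kdZ x a u t : kd x (fun s => a * u s) t = a * kd x u t.
Proof. by elim: t u => /= [|i t IHt] u; rewrite ?mulr0 // IHt; ring. Qed.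

Lemma kdB x u v t : kd x (fun s => u s - v s) t = kd x u t - kd x v t.
Proof. by elim: t u v => /= [|i t IHt] u v; rewrite ?subr0 // IHt; ring. Qed.

Lemma kd_sum x (F : I -> seq I -> R) t :
  kd x (fun s => \sum_i F i s) t = \sum_i kd x (F i) t.
Proof.
elim: t F => /= [|i t IHt] F; first by rewrite big1.
by rewrite IHt mulr_sumr -sumrB.
Qed.

Lemma kd_lin x y a u t :
  kd (fun i => x i + a * y i) u t = kd x u t + a * kd y u t.
Proof. by elim: t u => /= [|i t IHt] u; rewrite ?mulr0 ?addr0 // IHt; ring. Qed.

Lemma kd_anticomm x y u t : kd x (kd y u) t = - kd y (kd x u) t.
Proof.
elim: t u => /= [|i t IHt] u; first by rewrite oppr0.
by rewrite !kdB !kdZ IHt; ring.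
Qed.

Lemma kdK x u t : kd x (kd x u) t = 0.
Proof. by elim: t u => //= i t IHt u; rewrite kdB kdZ IHt; ring. Qed.

Lemma kd_ideal x J n u : is_ideal J -> (forall s, size s = n -> J (u s)) ->
  forall t, size t = n.+1 -> J (kd x u t).
Proof.
move=> idJ; have [J0 JD JM] := idJ.
elim: n u => [|n IHn] u Ju [|i t] //= [st]; apply: idealB => //.
- by apply/JM/Ju.
- by case: t st.
- by apply/JM/Ju.
- by apply: IHn st => s ss; apply: Ju; rewrite /= ss.
Qed.

(** Contraction with [r] is a homotopy from multiplication by the combination of the [x i] to
    zero. *)
Lemma kd_homotopy x (r : I -> R) u t :
  (\sum_i r i * x i) * u t
  = kd x (fun s => \sum_i r i * u (i :: s)) t + \sum_i r i * kd x u (i :: t).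
Proof.
rewrite kd_sum -big_split mulr_suml; apply: eq_bigr => i _ /=.
by rewrite kdZ; ring.
Qed.

(* The induction lowers the degree [n] while lengthening the initial segment
   [take k a]: the homotopy turns a cocycle modulo [take k a] into a cocycle
   of degree [n - 1] modulo [take k.+1 a]. *)
Lemma regular_seq_kd_exact x (a : seq R) :
  regular_seq a -> (forall b, b \in a -> exists r : I -> R, b = \sum_i r i * x i) ->
  forall n k, (k + n < size a)%N -> forall u,
  (forall t, size t = n.+1 -> ideal_gen (fun b => b \in take k a) (kd x u t)) ->
  exists v, forall t, size t = n ->
    ideal_gen (fun b => b \in take k a) (u t - kd x v t).
Proof.
move=> [_ reg] ax; elim=> [|n IHn] k ltk u du.
  (* In degree 0 each [x i * u [::]] lies in the ideal, hence so does the next element of [a] times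
     [u [::]], and regularity applies. [v] is zero, as [kd] vanishes on the empty word. *)
  rewrite addn0 in ltk; exists (fun=> 0) => -[] // _ /=; rewrite subr0.
  have [r ar] := ax _ (mem_nth 0 ltk).
  apply: reg ltk _; rewrite mulrC ar kd_homotopy /= add0r.
  have idk := ideal_genP (fun b => b \in take k a); have [_ _ IM] := idk.
  by apply: ideal_sum => // i; apply/IM/(du [:: i]).
have lt_k : (k < size a)%N by apply: leq_ltn_trans ltk; apply: leq_addr.
set Ik := ideal_gen (fun b => b \in take k a) in du *.
have idk : is_ideal Ik by apply: ideal_genP.
have [I0 ID IM] := idk.
have [r ar] := ax _ (mem_nth 0 lt_k).
(* The contraction of [u] with [r]: by the homotopy its coboundary is, modulo [Ik], the next element
   of [a] times [u]. *)
pose w s := \sum_i r i * u (i :: s).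
have awE t : size t = n.+1 -> Ik (a`_k * u t - kd x w t).
  move=> st; rewrite ar kd_homotopy addrC addKr.
  by apply: ideal_sum => // i; apply/IM/du; rewrite /= st.
have IkS : sub_ideal Ik (ideal_gen (fun b => b \in take k.+1 a)).
  apply: ideal_gen_sub (ideal_genP _) _ => c ck; apply: mem_ideal_gen.
  by rewrite (take_nth 0) // mem_rcons inE ck orbT.
have [|t st|v dv] := IHn k.+1 _ w; first by rewrite addSnnS.
  have [_ ID' _] := ideal_genP (fun b => b \in take k.+1 a).
  rewrite -[kd x w t](subrK (a`_k * u t)); apply: ID'.
    apply: IkS; rewrite -opprB -mulN1r; exact/IM/awE.
  rewrite mulrC; have [_ _ IM'] := ideal_genP (fun b => b \in take k.+1 a).
  apply/IM'/mem_ideal_gen; by rewrite (take_nth 0) // mem_rcons mem_head.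
have splitk : sub_ideal (ideal_gen (fun b => b \in take k.+1 a))
    (fun c => exists g, Ik (c - a`_k * g)).
  have idJ : is_ideal (fun c => exists g, Ik (c - a`_k * g)).
    split=> [|b c' [g Ig] [g' Ig']|d b [g Ig]].
    - by exists 0; rewrite mulr0 subr0.
    - by exists (g + g'); rewrite mulrDr opprD addrACA; apply: ID.
    - by exists (d * g); rewrite mulrCA -mulrBr; apply: IM.
  apply: ideal_gen_sub idJ _ => c; rewrite (take_nth 0) // mem_rcons inE.
  case/orP => [/eqP->|ck]; first by exists 1; rewrite mulr1 subrr.
  by exists 0; rewrite mulr0 subr0; apply: mem_ideal_gen.
have [g gE] : exists g : seq I -> R,
    forall t, size t = n -> Ik (w t - kd x v t - a`_k * g t).
  apply: (ClassicalEpsilon.choice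
    (fun t c => size t = n -> Ik (w t - kd x v t - a`_k * c))) => t.
  have [/dv/splitk[c Ic]|nst] := classic (size t = n); first by exists c.
  by exists 0 => /nst.
exists g => t st; apply: (reg k) => //.
(* As [kd] squares to zero, the term in [v] drops out; both summands on the right lie in [Ik]. *)
have -> : (u t - kd x g t) * a`_k = (a`_k * u t - kd x w t)
   + kd x (fun s => w s - kd x v s - a`_k * g s) t.
  rewrite !kdB kdZ kdK; ring.
by apply: ID; [apply: awE|apply: kd_ideal gE _ st].
Qed.

End Koszul.

Lemma kd_morph (R R' : comNzRingType) (I : finType) (f : {rmorphism R -> R'})
    (x : I -> R) u t :
  kd (fun i => f (x i)) (fun s => f (u s)) t = f (kd x u t).
Proof.
elim: t u => /= [|i t IHt] u; first by rewrite rmorph0.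
by rewrite rmorphB rmorphM /= -IHt.
Qed.

(** * Search for the facets of A *)

Local Close Scope ring_scope.

Fixpoint sublists (T : Type) (s : seq T) : seq (seq T) :=
  if s is x :: s' then sublists s' ++ map (cons x) (sublists s') else [:: [::]].

Lemma filter_sublists (T : eqType) (a : pred T) s : filter a s \in sublists s.
Proof.
elim: s => //= x s IHs; rewrite mem_cat; case: (a x); last by rewrite IHs.
by rewrite map_f ?orbT.
Qed.

Definition sublist (s t : seq nat) := all (mem t) s.

(* Vertex [k] stands for the variable x_(k+1). *)
Definition nonfaces := [:: [:: 1; 2; 3]; [:: 0; 2; 4]; [:: 1; 2; 4];
  [:: 0; 3; 4]; [:: 2; 3; 4]; [:: 0; 1; 5]; [:: 1; 2; 5]; [:: 0; 3; 5];
  [:: 1; 3; 5]; [:: 0; 4; 5]].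

Definition is_nonface (s : seq nat) := has (fun T => sublist T s) nonfaces.

Definition triangles :=
  [seq s <- sublists (iota 0 6) | (size s == 3) && ~~ is_nonface s].

Definition tets := [seq s <- sublists (iota 0 6) | size s == 4].

(** Dropping the common vertex 3 leaves the triangles 012, 014, 025, 145, 245 of the Moebius
    strip. *)
Definition cone_facets := [:: [:: 0; 1; 2; 3]; [:: 0; 1; 3; 4];
  [:: 0; 2; 3; 5]; [:: 1; 3; 4; 5]; [:: 2; 3; 4; 5]].

(** The monomial of f on [t] is not constant and divides the monomial of every nonface inside
    [t]. *)
Definition labels (t : seq nat) := [seq p <- sublists (iota 0 6) |
  (p != [::]) && all (fun T => sublist T t ==> sublist p T) nonfaces].

(* [c = (t, p)]: a facet [t] of A with the variables [p] of the monomial to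
   which f restricts on [t]. *)
Definition compatible (c c' : seq nat * seq nat) :=
  (sublist c.2 c'.1 ==> (c'.2 == c.2)) &&
  all (fun T => sublist T c.1 && sublist [seq k <- T | k \notin c.2] c'.1
                ==> sublist T c'.1) nonfaces.

(** Since A lies in [I_Delta], each triangle of Delta lies in a facet of A; a list of candidates
    missing one is hopeless. *)
Definition uncovered (ts : seq (seq nat)) :=
  has (fun F => ~~ has (sublist F) ts) triangles.
Arguments uncovered : simpl never.

Fixpoint search (todo : seq (seq nat)) (cur : seq (seq nat * seq nat)) : bool :=
  if uncovered (todo ++ map fst cur) then true
  else if todo is t :: todo' then
    if search todo' cur then
      all (fun p => if all (fun c => compatible c (t, p) && compatible (t, p) c) cur
                    then search todo' ((t, p) :: cur) else true) (labels t)
    else false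
  else all (fun c => c.1 \in cone_facets) cur.

(** The actual facets, labelled by [phi], determine one branch of the search. No pruning test
    applies on it, so its leaf test holds of them. *)
Lemma search_sound (fac : pred (seq nat)) (phi : seq nat -> seq nat) :
  (forall t, t \in tets -> fac t -> phi t \in labels t) ->
  (forall t u, t \in tets -> u \in tets -> fac t -> fac u ->
     compatible (t, phi t) (u, phi u)) ->
  (forall F, F \in triangles -> exists t, [/\ t \in tets, fac t & sublist F t]) ->
  forall t, t \in tets -> fac t -> t \in cone_facets.
Proof.
move=> labelP compP coverP.
suff main todo cur : search todo cur -> {subset todo <= tets} ->
    (forall c, c \in cur -> [/\ c.1 \in tets, fac c.1 & c.2 = phi c.1]) ->
    (forall t, t \in tets -> fac t -> t \in todo ++ map fst cur) ->
    forall t, t \in tets -> fac t -> t \in cone_facets.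
  by apply: (main tets [::]) => [|||t tt ft]; [vm_compute| | |rewrite cats0].
elim: todo cur => [|t todo IH] cur /= + subt curP allP u ut fu.
  case: ifP => [/hasP[F /coverP[v [vt fv Fv]] /hasPn/(_ v (allP _ vt fv))]|_].
    by rewrite Fv.
  by move=> /seq.allP H; have /mapP[c cc ->] := allP u ut fu; apply: H.
case: ifP => [/hasP[F /coverP[v [vt fv Fv]] /hasPn/(_ v (allP _ vt fv))]|_].
  by rewrite Fv.
have tt : t \in tets by apply: subt; rewrite mem_head.
have subt' : {subset todo <= tets} by move=> v vt; apply: subt; rewrite inE vt orbT.
case: ifP => // s1 s2; case: (boolP (fac t)) => ft; last first.
  apply: (IH cur) => // v vt fv; have := allP v vt fv; rewrite /= inE.
  by case: eqP fv ft => [-> ->|].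
apply: (IH ((t, phi t) :: cur)) => //; last 1 first.
- by move=> v vt fv; have := allP v vt fv; rewrite /= inE !mem_cat inE orbCA.
- have := seq.allP s2 _ (labelP t tt ft); case: ifP => // /negbT/allPn[c cc].
  case: c cc => c1 c2 /curP /= [tc fc ->]; by rewrite !compP.
- by move=> c; rewrite inE => /orP[/eqP->|/curP].
Qed.

(** * Translation between vertex sets and lists *)

Definition set_of_list (s : seq nat) : {set 'I_6} := [set i : 'I_6 | (i : nat) \in s].

Definition list_of_set (V : {set 'I_6}) : seq nat :=
  [seq k <- iota 0 6 | inord k \in V].

Lemma mem_list_of_set V (i : 'I_6) : ((i : nat) \in list_of_set V) = (i \in V).
Proof. by rewrite /list_of_set mem_filter inord_val mem_iota leq0n ltn_ord !andbT. Qed.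

Lemma list_of_setK V : set_of_list (list_of_set V) = V.
Proof. by apply/setP => i; rewrite inE mem_list_of_set. Qed.

Lemma set_of_listK s : s \in sublists (iota 0 6) -> list_of_set (set_of_list s) = s.
Proof.
suff: all (fun s => [seq k <- iota 0 6 | k \in s] == s) (sublists (iota 0 6)).
  move=> /allP H /H /eqP {2}<-; apply: eq_in_filter => k.
  by rewrite mem_iota => /andP[_ ltk]; rewrite inE /= inordK.
by vm_compute.
Qed.

Lemma list_of_set_sublists V : list_of_set V \in sublists (iota 0 6).
Proof. exact: filter_sublists. Qed.

Lemma sublist_list_of_set V W : sublist (list_of_set V) (list_of_set W) = (V \subset W).
Proof.
apply/allP/subsetP => [sub i|sub k]; first by rewrite -!mem_list_of_set => /sub.
rewrite /list_of_set mem_filter mem_iota /= => /andP[kV ltk].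
by rewrite -[k](@inordK 5) //= mem_list_of_set sub.
Qed.

Lemma size_list_of_set V : size (list_of_set V) = #|V|.
Proof.
rewrite cardE -(size_map val); congr size.
rewrite /list_of_set -val_enum_ord filter_map; congr map.
by rewrite enumT; apply: eq_filter => i /=; rewrite inord_val.
Qed.

Lemma list_of_set_tets V : (list_of_set V \in tets) = (#|V| == 4).
Proof. by rewrite /tets mem_filter list_of_set_sublists andbT size_list_of_set. Qed.

Lemma nonface_sublists T : T \in nonfaces -> T \in sublists (iota 0 6).
Proof. by move: T; apply/allP; vm_compute. Qed.

Local Open Scope ring_scope.

(** * The cone over the Moebius strip *)

Section Quotients.
Variables (R Q : comNzRingType) (A : R -> Prop) (pi : {rmorphism R -> Q}).
Hypothesis piA : is_quotient A pi.
Implicit Types P : R -> Prop.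

Lemma mem_image_subset P x : is_ideal P -> sub_ideal A P ->
  image_subset pi P (pi x) <-> P x.
Proof.
move=> idP AP; split=> [[y [Py yx]]|Px]; last by exists x.
rewrite -[x](subKr y); apply: idealB => //; apply: AP.
by apply/(proj2 piA); rewrite rmorphB yx subrr.
Qed.

Lemma image_subset_prime P : prime_idl P -> sub_ideal A P ->
  prime_idl (image_subset pi P).
Proof.
move=> [[idP P1] Pp] AP; have [surj _] := piA.
have imP := mem_image_subset _ idP AP; have [P0 PD PM] := idP.
split; first split; first split.
- by exists 0; rewrite rmorph0.
- by move=> _ _ [x [Px <-]] [y [Py <-]]; exists (x + y); rewrite rmorphD; split; auto.
- move=> b _ [x [Px <-]]; have [a <-] := surj b.
  by exists (a * x); rewrite rmorphM; split; auto.
- by rewrite -(rmorph1 pi) => /imP.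
- move=> a b; have [x <-] := surj a; have [y <-] := surj b.
  by rewrite -rmorphM => /imP /Pp [] /imP; [left|right].
Qed.

End Quotients.

(** The shape of [kd] on a word of length 3: the variables factor out, leaving the simplicial
    coboundary of the coefficients. *)
Lemma cocycle_factor (R : comNzRingType) (a b c : int) (p q r : R) :
  p * (a%:~R * (q * r)) - (q * (b%:~R * (p * r)) - (r * (c%:~R * (p * q)) - 0))
  = (a - b + c)%:~R * (p * q * r).
Proof. by rewrite intrD intrB; ring. Qed.

Section MaximalIdeal.
Variables (n : nat) (K : fieldType).

Lemma vprimeT_sum (p : {mpoly K[n]}) : vprime [set: 'I_n] p ->
  exists r : 'I_n -> {mpoly K[n]}, p = \sum_i r i * 'X_i.
Proof.
move=> /vprimeP Vp; rewrite [p]mpolyE big_seq.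
apply: (big_ind (fun p => exists r : 'I_n -> {mpoly K[n]}, p = \sum_i r i * 'X_i)).
- by exists (fun=> 0); rewrite big1 // => i _; rewrite mul0r.
- move=> _ _ [r ->] [s ->]; exists (fun i => r i + s i).
  by rewrite -big_split; apply: eq_bigr => i _; rewrite mulrDl.
- move=> m; rewrite mcoeff_msupp => /Vp /subsetPn[i]; rewrite inE => mi _.
  exists (fun j => if j == i then p@_m *: 'X_[m - U_(i)] else 0).
  rewrite (bigD1 i) //= eqxx big1 ?addr0 => [|j /negbTE ->]; last by rewrite mul0r.
  by rewrite -scalerAl -mpolyX_split.
Qed.

(** An ideal containing this image and one more element contains the nonzero constant term of a
    preimage, which is a unit. *)
Lemma image_vprimeT_maximal (Q : comNzRingType) A
    (pi : {rmorphism {mpoly K[n]} -> Q}) :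
  is_quotient A pi -> sub_ideal A (vprime [set: 'I_n]) ->
  maximal_idl (image_subset pi (vprime [set: 'I_n])).
Proof.
move=> piA AV; have [prM _] := image_subset_prime piA (vprime_prime K setT) AV.
split=> // J [idJ J1] MJ q Jq; have [surj _] := piA; have [J0 JD JM] := idJ.
have [p pq] := surj q; exists p; split=> //; apply: NNPP => nVp; apply: J1.
have p0 : p@_0%MM != 0.
  apply/negP => /eqP p0; apply: nVp; apply/vprimeP => m pm; apply/negP.
  rewrite setCT subset0 => /eqP /mem_mvars0 m0.
  by rewrite m0 p0 eqxx in pm.
have Vr : vprime [set: 'I_n] (p - (p@_0%MM)%:MP).
  apply/vprimeP => m; rewrite setCT subset0 mcoeffB mcoeffC.
  apply: contraNN => /eqP /mem_mvars0 ->; by rewrite eqxx mulr1 subrr.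
have Jc : J (pi (p@_0%MM)%:MP).
  rewrite -[_%:MP](subKr p) rmorphB /=; apply: idealB => //; first by rewrite pq.
  by apply: MJ; exists (p - (p@_0%MM)%:MP).
rewrite -(rmorph1 pi) -[1](_ : (p@_0%MM)^-1%:MP * (p@_0%MM)%:MP = 1).
  by rewrite rmorphM; apply: JM.
by rewrite -mpolyCM mulVf.
Qed.

End MaximalIdeal.

(** * A Koszul class obstructing Cohen-Macaulayness *)

Section Moebius.
Local Notation S := {mpoly rat[6]}.
Variable A : S -> Prop.
Hypothesis sqA : squarefree_monomial_ideal A.

(* The edges crossed by an arc joining two boundary points of the strip
   through the triangles {0,1,2} and {0,2,5}; it does not disconnect the strip,
   so the dual cocycle is not a coboundary. *)
Definition edge (i j : nat) : bool := (i, j) \in [:: (0, 2); (0, 5); (1, 2)]%N.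

Definition cocycle (i j : nat) : int := (edge i j : nat)%:Z - (edge j i : nat)%:Z.

Definition moebius_nonfaces : seq (seq nat) :=
  [:: [:: 0; 2; 4]; [:: 1; 2; 4]; [:: 0; 1; 5]; [:: 1; 2; 5]; [:: 0; 4; 5]]%N.

(** A finite check that the coboundary vanishes on the triangles of the strip, whose vertices
    exclude the apex 3. *)
Lemma cocycleP (i j k : nat) : (i < 6)%N -> (j < 6)%N -> (k < 6)%N ->
  3%N \notin [:: i; j; k] -> cocycle j k - cocycle i k + cocycle i j != 0 ->
  exists2 T, T \in moebius_nonfaces & sublist T [:: i; j; k].
Proof.
move=> lti ltj ltk; suff: all (fun i => all (fun j => all (fun k =>
    [|| 3%N \in [:: i; j; k], cocycle j k - cocycle i k + cocycle i j == 0
      | has (fun T => sublist T [:: i; j; k]) moebius_nonfaces])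
    (iota 0 6)) (iota 0 6)) (iota 0 6).
  move=> /allP/(_ i)/[!mem_iota]/(_ lti)/allP/(_ j)/[!mem_iota]/(_ ltj).
  move=> /allP/(_ k)/[!mem_iota]/(_ ltk)/or3P[-> //|/eqP-> //|/hasP //].
by vm_compute.
Qed.

(** [o] is the apex. [x] splits as [x'] plus ['X_o] times [delta], and [y] turns the simplicial
    cocycle into a Koszul cochain of degree 2. *)
Let o : 'I_6 := inord 3.
Let x (i : 'I_6) : S := 'X_i.
Let x' (i : 'I_6) : S := if i == o then 0 else 'X_i.
Let delta (i : 'I_6) : S := (i == o)%:R.
Let y (s : seq 'I_6) : S :=
  if s is [:: i; j] then (cocycle i j)%:~R * (x' i * x' j) else 0.

Hypothesis moebiusA :
  forall T, T \in moebius_nonfaces -> A 'X_[sqfree (set_of_list T)].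

Lemma kd_y_mem s : size s = 3 -> A (kd x' y s).
Proof.
case: s => [|i [|j [|k []]]] //= _.
rewrite cocycle_factor.
have [A0 _ AM] := sqfree_ideal sqA.
have [->|c0] := eqVneq (cocycle j k - cocycle i k + cocycle i j) 0.
  by rewrite mul0r.
apply: AM; rewrite /x'.
case: (eqVneq i o) => [_|io]; first by rewrite !mul0r.
case: (eqVneq j o) => [_|jo]; first by rewrite mulr0 mul0r.
case: (eqVneq k o) => [_|ko]; first by rewrite mulr0.
have ne_o (a : 'I_6) : a != o -> (3 == a :> nat) = false.
  by rewrite eq_sym -val_eqE /= inordK //; apply: negbTE.
have [||||T mT sT] := cocycleP _ _ _ _ c0; rewrite ?ltn_ord //.
  by rewrite !inE !ne_o.
rewrite -!mpolyXD; apply: sqfree_idealXS (moebiusA mT) => //.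
rewrite mvars_sqfree; apply/subsetP => a; rewrite !inE => /(allP sT).
rewrite !inE !mnmDE !mnm1E /= !addn_eq0 !eqb0 -!val_eqE /=.
by rewrite ![a == _ :> nat]eq_sym; do 3 case: eqP.
Qed.

(* The product of the class [delta] of the apex with the cocycle [y]. *)
Let z := kd delta y.

(** In the splitting of [x], the [delta] part kills [z] because [kd delta] squares to zero; the [x']
    part anticommutes with [kd delta], leaving [kd delta] of [kd x' y], which has values in [A]. *)
Lemma kd_z_mem t : size t = 4 -> A (kd x z t).
Proof.
move=> st; have xE : x =1 (fun i => x' i + 'X_o * delta i).
  move=> i; rewrite /x /x' /delta; case: eqP => [->|_].
    by rewrite add0r mulr1.
  by rewrite mulr0 addr0.
rewrite (eq_kdl _ _ xE) kd_lin kdK mulr0 addr0 kd_anticomm -mulN1r.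
have idA := sqfree_ideal sqA; have [_ _ AM] := idA; apply: AM.
by apply: kd_ideal st => // s; apply: kd_y_mem.
Qed.

Hypothesis pairA : forall i j : 'I_6, ~ A 'X_[U_(i) + U_(j)].

Lemma mcoeffMX0 (p : S) (i : 'I_6) (m : 'X_{1..6}) : m i = 0%N -> (p * 'X_i)@_m = 0.
Proof.
move=> mi; apply/memN_msupp_eq0; rewrite (perm_mem (msuppMX _ _)).
by apply/negP => /mapP[m' _ mE]; rewrite mE mnmDE mnm1E eqxx in mi.
Qed.

(** As [A] contains no product of two variables, comparing coefficients of such products on words
    starting with [o] makes the cocycle the coboundary of a function [g] on vertices, up to sign. *)
Lemma z_not_coboundary (V : seq 'I_6 -> S) :
  ~ forall t, size t = 3 -> A (z t - kd x V t).
Proof.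
move=> H; pose g i := (V [:: o; i])@_U_(i).
have gE i j : i != o -> j != o -> i != j -> (cocycle i j)%:~R = g i - g j :> rat.
  move=> io jo ij; have Aij := H [:: o; i; j] erefl.
  have : (z [:: o; i; j] - kd x V [:: o; i; j])@_(U_(i) + U_(j)) = 0.
    apply/eqP/negPn/negP => nz; apply: (pairA (i := i) (j := j)).
    exact: (sqfree_ideal_mcoeff sqA Aij nz).
  have -> : z [:: o; i; j] = (cocycle i j)%:~R * 'X_[U_(i) + U_(j)].
    rewrite /z /= /delta eqxx (negbTE io) (negbTE jo) /x' (negbTE io) (negbTE jo).
    by rewrite mul1r !mul0r !subr0 mpolyXD.
  have -> : kd x V [:: o; i; j] =
      V [:: i; j] * x o - (V [:: o; j] * x i - V [:: o; i] * x j).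
    by rewrite /= subr0 ![_ * x _]mulrC.
  rewrite !mcoeffB mcoeffMX0; last first.
    by rewrite mnmDE !mnm1E (negbTE io) (negbTE jo).
  rewrite /x mcoeffMX [X in (_ * 'X_j)@_X]addmC mcoeffMX.
  rewrite -(rmorph_int (@mpolyC 6 rat)) mcoeffCM mcoeffX eqxx mulr1 sub0r opprK => /eqP.
  by rewrite addr_eq0 opprB => /eqP.
have ne (a b : nat) : (a < 6)%N -> (b < 6)%N -> a != b -> inord a != inord b :> 'I_6.
  by move=> lta ltb; rewrite -val_eqE /= !inordK.
have gN (a b : nat) : (a < 6)%N -> (b < 6)%N -> a != 3%N -> b != 3%N -> a != b ->
    (cocycle a b)%:~R = g (inord a) - g (inord b) :> rat.
  by move=> lta ltb a3 b3 ab; rewrite -gE ?ne // !inordK.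
have eqg a b : (a < 6)%N -> (b < 6)%N -> a != 3%N -> b != 3%N -> a != b ->
    cocycle a b = 0 -> g (inord a) = g (inord b).
  move=> lta ltb a3 b3 ab c0; apply/eqP; rewrite -subr_eq0 -gN //.
  by rewrite c0.
(* The path 0, 1, 4, 5, 2 runs around the strip: the cocycle vanishes on its four edges but is 1 on
   the edge from 0 to 2 closing it. *)
have := gN 0%N 2%N isT isT isT isT isT.
rewrite (eqg 0%N 1%N) // (eqg 1%N 4%N) // (eqg 4%N 5%N) // (eqg 5%N 2%N) //.
by rewrite subrr.
Qed.

(** The face 0123 gives a chain of five primes, so the maximal ideal has height, hence depth, at
    least 4; exactness in degree 3 then contradicts the class of [z]. *)
Lemma moebius_facet_not_cm : ~ A 'X_[sqfree (set_of_list [:: 0; 1; 2; 3]%N)] ->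
  ~ quotient_cohen_macaulay A.
Proof.
move=> nA [Q [pi [piA CM]]]; have [surj kerA] := piA.
(* [V 0] is the complement of 0123; each step adds a vertex until [V 4] is everything. *)
pose V k : {set 'I_6} := [set i : 'I_6 | (3 < i)%N || (i < k)%N].
have AV k : sub_ideal A (vprime (V k)).
  move=> p /(proj2 (sub_vprimeP sqA (V 0%N)) _) H.
  apply: vprime_sub (H _); first by apply/subsetP => i; rewrite !inE ltn0 orbF => ->.
  move: nA; rewrite (_ : set_of_list _ = ~: V 0%N) //.
  apply/setP => i; rewrite !inE ltn0 orbF -leqNgt.
  by case: i => -[|[|[|[|[|[|]]]]]].
have VT : V 6%N = setT by apply/setP => i; rewrite !inE ltn_ord orbT.
have AT : sub_ideal A (vprime [set: 'I_6]) by rewrite -VT.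
have maxM := image_vprimeT_maximal piA AT.
set M := image_subset pi (vprime [set: 'I_6]) in maxM.
have [n [[[s [reg sM sn]] _] [[P [prP MP [_ maxP]]] _]]] := CM M maxM.
have PM : sub_ideal P M by case: maxM => _; apply=> //; case: prP.
have idV k := proj1 (proj1 (vprime_prime rat (V k))).
have imV k a : image_subset pi (vprime (V k)) (pi a) <-> vprime (V k) a.
  exact: mem_image_subset (idV k) (AV k).
have n4 : (4 <= n)%N.
  apply: (maxP 4%N (fun k => image_subset pi (vprime (V k)))); last first.
    have -> : V 4%N = setT by apply/setP => i; rewrite !inE ltnS; case: ltnP.
    by move=> a; split=> [/MP|/PM].
  split=> k lek; first exact: (image_subset_prime piA (vprime_prime rat (V k)) (AV k)).
  split=> [a|sub].
    have [p <-] := surj a => /imV Vp; apply/imV.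
    apply: vprime_sub Vp; apply/subsetP => i; rewrite !inE => /orP[->//|lt_ik].
    by rewrite ltnS (ltnW lt_ik) orbT.
  have /vprime_subset/subsetP/(_ (inord k)) :
      sub_ideal (@vprime 6 rat (V k.+1)) (vprime (V k)).
    by move=> p Vp; apply/imV/sub/imV.
  have lt6 : (k < 6)%N by apply: leq_trans lek _.
  by rewrite !inE inordK // ltnSn ltnn orbT orbF ltnNge -ltnS lek => /(_ isT).
have sx b : b \in s -> exists r : 'I_6 -> Q, b = \sum_i r i * pi (x i).
  move=> /sM [p [/vprimeT_sum[r ->] <-]]; exists (fun i => pi (r i)).
  by rewrite rmorph_sum; apply: eq_bigr => i _; rewrite rmorphM.
(* With [k := 0] the ideal has no generators, hence is zero; degree 3 requires length at least 4. *)
have [||v vE] := regular_seq_kd_exact reg sx (n := 3) (k := 0) _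
  (u := fun t => pi (z t)) _.
- by rewrite sn.
- move=> t st; rewrite kd_morph (proj2 (kerA _)); last exact: kd_z_mem.
  by case: (ideal_genP (fun b => b \in take 0 s)).
have [lift liftK] := ClassicalEpsilon.choice _ surj.
apply: (@z_not_coboundary (fun t => lift (v t))) => t st; apply/kerA.
have kE : pi (kd x (fun t => lift (v t)) t) = kd (fun i => pi (x i)) v t.
  by rewrite -kd_morph; apply: eq_kd => r; apply: liftK.
rewrite rmorphB kE.
have id0 : is_ideal (fun b : Q => b = 0).
  by split=> [//|a b -> ->|a b ->]; rewrite ?addr0 ?mulr0.
by apply: (ideal_gen_sub id0) (vE t st) => b; rewrite take0.
Qed.

End Moebius.

(** * The link *)

Section StanleyReisner.
Local Notation S := {mpoly rat[6]}.

Lemma xvar3 (a b c : nat) : (a < 6)%N -> (b < 6)%N -> (c < 6)%N ->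
  uniq [:: a; b; c] ->
  xvar a.+1 * xvar b.+1 * xvar c.+1 = 'X_[sqfree (set_of_list [:: a; b; c])].
Proof.
move=> lta ltb ltc; rewrite /xvar -!mpolyXD => uabc; congr 'X_[_].
apply/mnmP => i; rewrite !mnmDE !mnm1E mnmE !inE -!val_eqE /= !inordK //.
move: uabc; rewrite /= !inE ![(i : nat) == _]eq_sym.
case: (eqVneq a i) => [->|_]; case: (eqVneq b i) => [bi|_];
  by case: (eqVneq c i) => [ci|_]; rewrite ?bi ?ci ?eqxx ?orbT ?andbF.
Qed.

Lemma I_Delta_sqfree : squarefree_monomial_ideal I_Delta.
Proof.
exists (fun m => exists2 T, T \in nonfaces & m = sqfree (set_of_list T)).
split=> [m [T _ ->] i|p]; first by rewrite mnmE leq_b1.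
pose gens := [seq 'X_[sqfree (set_of_list T)] : S | T <- nonfaces].
have gensE : I_Delta = ideal_gen (fun p => p \in gens).
  by rewrite /I_Delta !xvar3.
rewrite gensE; split; apply: ideal_gen_sub (ideal_genP _) _ _ => q.
  move=> /mapP[T TN ->]; apply: mem_ideal_gen; exists (sqfree (set_of_list T)).
  by split=> //; exists T.
move=> [m [[T TN ->] ->]]; apply: mem_ideal_gen.
exact: (map_f (fun T => 'X_[sqfree (set_of_list T)] : S) TN).
Qed.

Lemma I_DeltaX V : I_Delta 'X_[sqfree V] <-> is_nonface (list_of_set V).
Proof.
have subT T : T \in nonfaces ->
    sublist T (list_of_set V) = (set_of_list T \subset V).
  by move=> TN; rewrite -{1}(set_of_listK (nonface_sublists TN)) sublist_list_of_set.
have [G [GE IE]] := I_Delta_sqfree; split; last first.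
  move=> /hasP[T TN]; rewrite subT // => sTV.
  apply: (sqfree_idealXS I_Delta_sqfree (m := sqfree (set_of_list T))).
    by rewrite !mvars_sqfree.
  have : T \in nonfaces := TN.
  rewrite /I_Delta !xvar3 // => _; apply: mem_ideal_gen.
  exact: (map_f (fun T => 'X_[sqfree (set_of_list T)] : S) TN).
apply: contraPT => /hasPn nV.
have sub : sub_ideal I_Delta (@vprime 6 rat (~: V)).
  rewrite /I_Delta !xvar3 //; apply: ideal_gen_sub => [|q].
    exact: (proj1 (proj1 (vprime_prime rat (~: V)))).
  move=> /(mapP (f := fun T => 'X_[sqfree (set_of_list T)] : S) (s := nonfaces)).
  move=> [T TN ->]; apply/vprimeX; rewrite mvars_sqfree setCK -subT //.
  exact: nV.
by move=> /sub /vprimeX; rewrite mvars_sqfree setCK subxx.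
Qed.

Lemma nonfaces_I_Delta T : T \in nonfaces -> I_Delta 'X_[sqfree (set_of_list T)].
Proof.
move=> TN; apply/I_DeltaX/hasP; exists T => //.
by rewrite set_of_listK ?nonface_sublists //; apply/allP.
Qed.

Lemma I_Delta_card V : ~ I_Delta 'X_[sqfree V] -> (#|V| <= 3)%N.
Proof.
move=> nV; rewrite -size_list_of_set; have : ~~ is_nonface (list_of_set V).
  by apply/negP => /I_DeltaX.
have : all (fun s => is_nonface s || (size s <= 3)%N) (sublists (iota 0 6)).
  by vm_compute.
by move/allP/(_ _ (list_of_set_sublists V)); case: is_nonface.
Qed.

End StanleyReisner.

Lemma list_of_setD V W :
  [seq k <- list_of_set V | k \notin list_of_set W] = list_of_set (V :\: W).
Proof.
rewrite -filter_predI; apply: eq_in_filter => k; rewrite mem_iota /= => ltk.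
by rewrite inE -{1}[k](@inordK 5) // mem_list_of_set.
Qed.

(** * Facets of A and restrictions of f to them *)

Section Link.
Local Notation S := {mpoly rat[6]}.
Variables (A B : S -> Prop) (f : S) (d : nat).
Hypothesis sqA : squarefree_monomial_ideal A.
Hypothesis sqB : squarefree_monomial_ideal B.
Hypothesis link : basic_double_G_link d f A B I_Delta.

Lemma I_DeltaE p : I_Delta p <-> exists b a, [/\ B b, A a & p = f * b + a].
Proof. by case: link. Qed.

Lemma sub_I_Delta : sub_ideal A I_Delta.
Proof.
move=> a Aa; apply/I_DeltaE; exists 0, a; split=> //; last by rewrite mulr0 add0r.
by have [B0 _ _] := sqfree_ideal sqB.
Qed.

Lemma I_Delta_sub : sub_ideal I_Delta B.
Proof.
move=> p /I_DeltaE [b [a [Bb Aa ->]]]; have [_ BD BM] := sqfree_ideal sqB.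
apply: BD; first exact: BM.
by case: link => -[_ _ _ AB] _ _ _ _; apply: AB.
Qed.

(** Otherwise [f] times the monomial of [G] is in [A], and so is the monomial, since [A : f = A]. *)
Lemma nonzerodivisor_facet G : facet A G -> ~ vprime (~: G) f.
Proof.
move=> fG /(facet_colon sqA fG) Af; apply: (proj1 fG).
by case: link => _ _ _ [_ _ /(_ 'X_[sqfree G])[H _]] _; apply: H; rewrite /colon mulrC.
Qed.

Lemma facet_card G : facet A G -> #|G| = 4.
Proof.
have [_ [unmA _ _ _] [h [htA htB]] _ _] := link.
have htf F (fF : facet A F) := unmixed_facet_height sqA unmA htA fF.
have [V [BV htV]] := height_cover sqB htB.
(* [V] also covers [I_Delta], so its complement is a face of Delta, with at most three vertices. *)
have cV : (3 <= #|V|)%N.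
  rewrite cardsCs card_ord -[3%N]/(6 - 3)%N leq_sub2l //; apply: I_Delta_card.
  apply: (proj1 (sub_vprimeP I_Delta_sqfree V)) => p /I_Delta_sub; exact: BV.
pose F := set_of_list [:: 0; 1; 2]%N.
have nF : ~ I_Delta 'X_[sqfree F].
  by move=> /I_DeltaX; rewrite set_of_listK.
have cF : #|F| = 3 by rewrite -size_list_of_set set_of_listK.
have [G0 fG0 FG0] : exists2 G0, facet A G0 & F \subset G0.
  by apply: facet_exists => // /sub_I_Delta.
have cG0 : #|~: G0| = 2.
  have := vprime_height_succ (htf _ fG0) htV => cVG0.
  have : (2 <= #|~: G0|)%N by rewrite -ltnS -cVG0.
  rewrite leq_eqVlt => /orP[/eqP // | lt2].
  (* Then the prime of [G0] contains [I_Delta], hence [f B]; it misses [f], so it contains [B], but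
     its height is only [h]. *)
  have eFG : F = G0.
    apply/eqP; rewrite eqEcard FG0 cF /= cardsCs card_ord leq_subLR.
    exact: (leq_add lt2 (leqnn 3)).
  have BG : sub_ideal B (vprime (~: G0)).
    move=> b Bb; have : vprime (~: G0) (f * b).
      apply: (proj2 (sub_vprimeP I_Delta_sqfree (~: G0))); first by rewrite setCK -eFG.
      apply/I_DeltaE; exists b, 0; rewrite addr0; split=> //.
      by have [A0 _ _] := sqfree_ideal sqA.
    have [_ prG] := vprime_prime rat (~: G0).
    by move=> /prG[/(nonzerodivisor_facet fG0)|].
  have [_ minB] := htB.
  by have := minB _ _ (vprime_prime _ _) BG (htf _ fG0); rewrite ltnn.
move=> fG; have := vprime_height_card_eq (htf _ fG) (htf _ fG0).
by rewrite cG0 [#|G|]cardsCs card_ord => ->.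
Qed.

Definition restricts_to G V :=
  exists2 c, c != 0 & varsub (~: G) f = c *: 'X_[sqfree V].

Lemma nonface_in_facet G : facet A G ->
  exists2 T, T \in nonfaces & set_of_list T \subset G.
Proof.
move=> fG; have: ~ ~ is_nonface (list_of_set G).
  move=> nG; have := I_Delta_card (fun H => nG (proj1 (I_DeltaX _) H)).
  by rewrite (facet_card fG).
move/NNPP/hasP => [T TN]; rewrite -{1}(set_of_listK (nonface_sublists TN)).
by rewrite sublist_list_of_set; exists T.
Qed.

Lemma varsubX_in (G T : {set 'I_6}) : T \subset G ->
  varsub (~: G) 'X_[sqfree T] = 'X_[sqfree T] :> S.
Proof. by move=> TG; rewrite varsubX mvars_sqfree setCK TG. Qed.

(** One [b] serves all facets; this relates the restrictions of [f] to different facets. *)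
Lemma varsub_nonface T : I_Delta 'X_[sqfree T] -> exists b, forall H,
  facet A H -> varsub (~: H) 'X_[sqfree T] = varsub (~: H) f * varsub (~: H) b.
Proof.
move=> /I_DeltaE [b [a [_ Aa E]]]; exists b => H [nAH _].
have aH : varsub (~: H) a = 0.
  by apply: (proj2 (sub_vprimeP sqA (~: H))) Aa; rewrite setCK.
by rewrite E rmorphD rmorphM /= aH addr0.
Qed.

(** The restriction of [f] divides the squarefree monomial of a nonface inside [G], so it is itself
    such a monomial up to a scalar. *)
Lemma restricts_toP G : facet A G -> exists V, restricts_to G V /\ V != set0.
Proof.
move=> fG; have [T TN TG] := nonface_in_facet fG.
have [b /(_ _ fG)] := varsub_nonface (nonfaces_I_Delta TN).
rewrite (varsubX_in TG) => /mpolyX_factor[c [_ [m [m' [c0 _ fE _ TE]]]]].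
have mE : m = sqfree (mvars m).
  apply/mnmP => i; rewrite mnmE inE.
  have : (m i <= 1)%N.
    by rewrite (leq_trans (leq_addr (m' i) (m i))) // -mnmDE -TE mnmE leq_b1.
  by case: (m i) => [|[]].
exists (mvars m); split; first by exists c; rewrite // -mE.
(* An empty [V] would give [f] a nonzero constant term, against its positive degree. *)
apply/eqP => m0; have [_ _ _ [d0 /dhomogP fd _] _] := link.
have fm : f@_m = c by apply: (varsub_mcoeff fE); rewrite m0 sub0set.
have := fd m; rewrite mcoeff_msupp fm => /(_ c0).
by rewrite (mem_mvars0 m0) /= mdeg0 => E0; rewrite -E0 in d0.
Qed.

(** On [G] the cofactor [b] is a multiple of the monomial of [T :\: V]. If [H] contains this set,
    [b] and [f] are nonzero on [H], and so is the monomial of [T]. *)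
Lemma restricts_to_nonface G V T : facet A G -> restricts_to G V ->
  I_Delta 'X_[sqfree T] -> T \subset G -> V \subset T /\
  forall H, facet A H -> T :\: V \subset H -> T \subset H.
Proof.
move=> fG [c c0 fE] IT TG; have [b bP] := varsub_nonface IT.
have := bP _ fG; rewrite (varsubX_in TG).
move=> /mpolyX_factor[c1 [c' [m1 [m' [c10 c'0 fE' bE TE]]]]].
have m1E : m1 = sqfree V by apply: (scaleX_inj c10 (etrans (esym fE') fE)).
rewrite {}m1E {fE' m1} in TE.
have VT : V \subset T.
  by rewrite -(mvars_sqfree T) TE mvarsD mvars_sqfree subsetUl.
split=> // H fH sub.
have m'E : mvars m' = T :\: V.
  apply/setP => i; rewrite !inE; have /mnmP/(_ i) := TE.
  rewrite mnmDE !mnmE; have := subsetP VT i.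
  by case: (i \in V) => [/(_ isT) ->|_]; case: (i \in T); case: (m' i) => [|[]].
have bm' : b@_m' = c'.
  by apply: (varsub_mcoeff bE); rewrite setCK m'E (subset_trans (subsetDl _ _) TG).
have bH : varsub (~: H) b <> 0.
  move=> /(congr1 (mcoeff m')); rewrite mcoeff_varsub setCK m'E sub bm' mcoeff0.
  by move/eqP; apply/negP.
apply/negPn/negP => nTH; have : varsub (~: H) 'X_[sqfree T] = 0 :> S.
  by rewrite varsubX mvars_sqfree setCK (negbTE nTH).
rewrite bP // => /eqP; rewrite mulf_eq0 => /orP[] /eqP //.
exact: nonzerodivisor_facet.
Qed.

Lemma restricts_to_overlap G H V W : restricts_to G V -> restricts_to H W ->
  V \subset G -> V \subset H -> W = V.
Proof.
move=> [c c0 fG] [c' _ fH] VG VH; rewrite -(mvars_sqfree W).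
rewrite (varsub_monomial_overlap c0 fG fH) ?mvars_sqfree ?setCK //.
Qed.

Lemma restricts_to_compatible G H V W : facet A G -> facet A H ->
  restricts_to G V -> restricts_to H W -> V \subset G ->
  compatible (list_of_set G, list_of_set V) (list_of_set H, list_of_set W).
Proof.
move=> fG fH rG rH VG; apply/andP; split.
  rewrite sublist_list_of_set; apply/implyP => VH.
  by rewrite (restricts_to_overlap rG rH VG VH).
apply/allP => T TN; have /esym TE := set_of_listK (nonface_sublists TN).
rewrite {}TE /= list_of_setD !sublist_list_of_set; apply/implyP => /andP[TG sub].
by have [_] := restricts_to_nonface fG rG (nonfaces_I_Delta TN) TG; apply.
Qed.

Lemma facet_cone G : facet A G -> list_of_set G \in cone_facets.
Proof.
have [phi phiP] : exists phi : {set 'I_6} -> {set 'I_6}, forall G, facet A G ->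
    restricts_to G (phi G) /\ phi G != set0.
  apply: (ClassicalEpsilon.choice
    (fun G V => facet A G -> restricts_to G V /\ V != set0)) => G'.
  have [/restricts_toP[V VP]|nf] := classic (facet A G'); first by exists V.
  by exists set0.
have [fac facP] : exists fac : {set 'I_6} -> bool, forall G, fac G <-> facet A G.
  apply: (ClassicalEpsilon.choice (fun G b => is_true b <-> facet A G)) => G'.
  by have [fG|nfG] := classic (facet A G'); [exists true|exists false].
have tetsE t : t \in tets -> list_of_set (set_of_list t) = t.
  by rewrite mem_filter => /andP[_ /set_of_listK].
have phi_sub H : facet A H -> phi H \subset H.
  move=> fH; have [T TN TH] := nonface_in_facet fH.
  have [rH _] := phiP _ fH.
  apply: subset_trans (TH).
  by case: (restricts_to_nonface fH rH (nonfaces_I_Delta TN) TH).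
move=> fG; apply: (@search_sound (fun t => fac (set_of_list t))
    (fun t => list_of_set (phi (set_of_list t)))).
- move=> t tt /facP ft; rewrite mem_filter list_of_set_sublists andbT.
  have [rt ne0] := phiP _ ft; apply/andP; split.
    by rewrite -size_eq0 size_list_of_set cards_eq0.
  apply/allP => T TN; apply/implyP.
  rewrite -{1}(tetsE t tt) -(set_of_listK (nonface_sublists TN)) !sublist_list_of_set.
  by move=> TG; case: (restricts_to_nonface ft rt (nonfaces_I_Delta TN) TG).
- move=> t u tt ut /facP ft /facP fu; have [rt _] := phiP _ ft.
  have [ru _] := phiP _ fu.
  have := restricts_to_compatible ft fu rt ru (phi_sub _ ft).
  by rewrite (tetsE t tt) (tetsE u ut).
- move=> F; rewrite mem_filter => /andP[/andP[sF nF] Fs].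
  have [|H fH FH] := @facet_exists _ _ A (set_of_list F).
    by move=> /sub_I_Delta /I_DeltaX; apply/negP; rewrite set_of_listK.
  exists (list_of_set H); rewrite list_of_set_tets facet_card // list_of_setK.
  by split=> //; [apply/facP|rewrite -(set_of_listK Fs) sublist_list_of_set].
- by rewrite list_of_set_tets facet_card.
- by rewrite list_of_setK; apply/facP.
Qed.

Lemma link_absurd : False.
Proof.
have [_ [_ _ cmA _] _ _ _] := link.
(* Every face of A extends to a facet, so a set inside no cone facet is a nonface. *)
have coneP T : list_of_set (set_of_list T) = T -> ~~ has (sublist T) cone_facets ->
    A 'X_[sqfree (set_of_list T)].
  move=> TE /hasPn nT; apply: NNPP => /facet_exists[G /facet_cone cG].
  by rewrite -sublist_list_of_set TE; apply/negP/nT.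
apply: (moebius_facet_not_cm sqA) cmA => [T TM|i j|].
- apply: coneP.
    by apply: set_of_listK; move: T TM; apply/allP; vm_compute.
  by move: T TM; apply/allP; vm_compute.
(* Generators of [I_Delta] involve three variables, more than a pair supplies. *)
- move=> /sub_I_Delta /(sqfree_idealX I_Delta_sqfree) /I_DeltaX /hasP[T TN /allP sT].
  have [uT szT] : uniq T /\ size T = 3.
    have /allP/(_ T TN)/andP[uT /eqP szT] :
      all (fun T => uniq T && (size T == 3)) nonfaces by [].
    by [].
  have := uniq_leq_size uT sT; rewrite szT size_list_of_set mvarsD.
  have mU (k : 'I_6) : mvars U_(k)%MM = [set k].
    by apply/setP => l; rewrite !inE mnm1E eqb0 negbK eq_sym.
  by rewrite !mU cards2; case: eqP.
(* Some facet contains the triangle 012 of Delta, and 0123 is the only cone facet that does. *)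
- have [|G fG sub] := @facet_exists _ _ A (set_of_list [:: 0; 1; 2]%N).
    by move=> /sub_I_Delta /I_DeltaX; rewrite set_of_listK.
  suff <- : list_of_set G = [:: 0; 1; 2; 3]%N by rewrite list_of_setK; case: fG.
  apply/eqP; move: sub; rewrite -sublist_list_of_set set_of_listK //.
  have : all (fun t => sublist [:: 0; 1; 2]%N t ==> (t == [:: 0; 1; 2; 3]%N))
      cone_facets.
    by vm_compute.
  by move/allP/(_ _ (facet_cone fG))/implyP.
Qed.

End Link.

Theorem proposition4p5 :
  ~ exists (A B : {mpoly rat[6]} -> Prop) (f : {mpoly rat[6]}) (d : nat),
      [/\ squarefree_monomial_ideal A,
          squarefree_monomial_ideal B,
          sum_of_monic_monomials f
        & basic_double_G_link d f A B I_Delta].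
Proof. by move=> [A [B [f [d [sqA sqB _ link]]]]]; apply: link_absurd link. Qed.
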